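(* Let $\kappa$ be a positive integer and let $c$ be a real number. For $a\in\mathbb{R}\setminus\{0,1\}$ let $m_n^{a,c;\kappa}$ denote the Krall Meixner polynomials (defined in the context), where $a$ is restricted to values for which $m_\kappa^{1/a,2-c}(-n)\neq 0$ so that $m_n^{a,c;\kappa}$ is well-defined. Then for every integer $n\ge 0$ and every $x\in\mathbb{R}$, $$\lim_{a\to 1}(a-1)^n\, m_n^{a,c;\kappa}\!\left(\frac{x}{1-a}\right)=\begin{cases} L_n^{c-2}(x), & \text{if } c\notin\{2,3,\dots,\kappa+1\},\\[2pt] L_n^{c-1;\infty}(x), & \text{if } c\in\{2,3,\dots,\kappa+1\},\end{cases}$$ where, for a positive integer $k$, $L_n^{k;\infty}(x)=L_n^{k}(x)-\frac{n+k}{n}L_{n-1}^{k}(x)$ for $n\ge 1$ and $L_0^{k;\infty}=1$.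
   Context: Binomials with real upper entry are generalized: $\binom{y}{j}=y(y-1)\cdots(y-j+1)/j!$. Meixner polynomials: for $a\ne 0,1$ and real $c$, $m_n^{a,c}(x)=\frac{a^n}{(1-a)^n}\sum_{j=0}^n a^{-j}\binom{x}{j}\binom{-x-c}{n-j}$ for $n\ge 0$, and $m_{-1}^{a,c}=0$. Laguerre polynomials: $L_n^{\alpha}(x)=\sum_{j=0}^n\frac{(-x)^j}{j!}\binom{n+\alpha}{n-j}$ for $n\ge0$ (any real $\alpha$). Krall Meixner polynomials: for a positive integer $\kappa$, $m_0^{a,c;\kappa}=1$ and for $n\ge 1$ $$m_n^{a,c;\kappa}(x)=m_n^{a,c}(x)+\frac{a\,m_{\kappa}^{1/a,2-c}(-n-1)}{(1-a)\,m_{\kappa}^{1/a,2-c}(-n)}\,m_{n-1}^{a,c}(x),$$ whenever $m_{\kappa}^{1/a,2-c}(-n)\ne 0$. (When $0<a<1$ and $c>\kappa+1$ the denominators do not vanish, and these polynomials are orthogonal with respect to $\sum_{x\ge 0}\prod_{j=1}^{\kappa}(x+c-j)\frac{a^x\Gamma(x+c-\kappa-1)}{x!}\delta_x$.) *)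

(* Defs.v *)
From mathcomp Require Import all_boot all_order all_algebra.
From mathcomp Require Import all_classical all_reals all_analysis.

Set Implicit Arguments.
Unset Strict Implicit.
Unset Printing Implicit Defensive.

Import Order.TTheory GRing.Theory Num.Theory.
Import numFieldNormedType.Exports.

Local Open Scope classical_set_scope.
Local Open Scope ring_scope.

(* y (y - 1) ... (y - j + 1) / j! *)
Definition gbinom (R : realType) (y : R) (j : nat) : R :=
  (\prod_(i < j) (y - i%:R)) / j`!%:R.

(* Meaningful for a != 0, 1. *)
Definition meixner (R : realType) (a c : R) (n : nat) (x : R) : R :=
  a ^+ n / (1 - a) ^+ n *
  \sum_(j < n.+1) a ^- j * gbinom x j * gbinom (- x - c) (n - j).

Definition laguerre (R : realType) (alpha : R) (n : nat) (x : R) : R :=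
  \sum_(j < n.+1) (- x) ^+ j / j`!%:R * gbinom (n%:R + alpha) (n - j).

(* The polynomials L_n^{k;oo}; intended for k a positive integer, here viewed
   as a real number. *)
Definition laguerre_infty (R : realType) (k : R) (n : nat) (x : R) : R :=
  match n with
  | 0 => 1
  | m.+1 => laguerre k n x - (n%:R + k) / n%:R * laguerre k m x
  end.

(* The parameters a for which the n-th Krall Meixner polynomial is defined; the
   degree 0 polynomial is the constant 1 and has no denominator. *)
Definition krall_meixner_dom (R : realType) (c : R) (kappa n : nat) : set R :=
  [set a | [/\ a != 0, a != 1 &
    (0 < n)%N -> meixner (1 / a) (2 - c) kappa (- n%:R) != 0]].

(* Meaningful for a in krall_meixner_dom c kappa n. *)
Definition krall_meixner (R : realType) (a c : R) (kappa n : nat) (x : R) : R :=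
  match n with
  | 0 => 1
  | m.+1 =>
      meixner a c n x
      + a * meixner (1 / a) (2 - c) kappa (- n%:R - 1)
        / ((1 - a) * meixner (1 / a) (2 - c) kappa (- n%:R))
        * meixner a c m x
  end.

(* Main.v *)
(* Expanding a^{-j} around 1 and applying Vandermonde's identity gives
     m_n^{a,c}(x) = (a / (1 - a))^n sum_j (1/a - 1)^j C(x, j) C(-c-j, n-j),
   in which no cancellation remains: (a - 1)^n m_n^{a,c}(x / (1 - a)) is a
   polynomial in a whose value at a = 1 is L_n^{c-1}(x).  The same formula shows
   that m_kappa^{1/a,2-c}(y) is, up to a factor independent of y, equal to
   sum_j (a - 1)^j C(y, j) C(c-2-j, kappa-j).  If r is the first index for which
   C(c-2-j, kappa-j) does not vanish, the quotient of the values at -n-1 and -n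
   tends to C(-n-1, r) / C(-n, r) = (n + r) / n, so the limit is
   L_n^{c-1} - (n + r)/n L_{n-1}^{c-1}.  Here r = c - 1 when c is in
   {2, ..., kappa+1}, and r = 0 otherwise; in the latter case the difference is
   L_n^{c-2} by Pascal's rule. *)
Require Import Defs.
From mathcomp Require Import all_boot all_order all_algebra.
From mathcomp Require Import all_classical all_reals all_analysis.
From mathcomp Require Import ring.

Set Implicit Arguments.
Unset Strict Implicit.
Unset Printing Implicit Defensive.

Import Order.TTheory GRing.Theory Num.Theory.
Import numFieldNormedType.Exports.

Local Open Scope classical_set_scope.
Local Open Scope ring_scope.

(** * Generalized binomial coefficients *)

Lemma gbinom0 (R : realType) (y : R) : gbinom y 0 = 1.
Proof. by rewrite /gbinom big_ord0 divr1. Qed.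

Lemma natS_neq0 (R : realType) (n : nat) : n.+1%:R != 0 :> R.
Proof. by rewrite pnatr_eq0. Qed.

Lemma fact_neq0 (R : realType) (n : nat) : n`!%:R != 0 :> R.
Proof. by rewrite pnatr_eq0 -lt0n fact_gt0. Qed.

Lemma mulSn_gbinom (R : realType) (y : R) (j : nat) :
  j.+1%:R * gbinom y j.+1 = (y - j%:R) * gbinom y j.
Proof.
rewrite /gbinom big_ord_recr /= factS natrM.
by field; rewrite fact_neq0 addrC natr1 natS_neq0.
Qed.

Lemma mulSn_gbinom_pred (R : realType) (y : R) (j : nat) :
  j.+1%:R * gbinom y j.+1 = y * gbinom (y - 1) j.
Proof.
rewrite /gbinom big_ord_recl /= subr0 factS natrM.
rewrite (eq_bigr (fun i : 'I_j => y - 1 - i%:R)); last first.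
  by move=> i _; rewrite /bump add1n -natr1; ring.
by field; rewrite fact_neq0 addrC natr1 natS_neq0.
Qed.

Lemma gbinom_pascal (R : realType) (y : R) (k : nat) :
  gbinom (y + 1) k.+1 = gbinom y k.+1 + gbinom y k.
Proof.
apply: (mulfI (natS_neq0 R k)).
rewrite mulSn_gbinom_pred addrK mulrDr mulSn_gbinom -natr1.
by ring.
Qed.

Lemma gbinom_vandermonde (R : realType) (x y : R) (n : nat) :
  \sum_(j < n.+1) gbinom x j * gbinom y (n - j) = gbinom (x + y) n.
Proof.
elim: n => [|n IH]; first by rewrite big_ord1 !gbinom0 mulr1.
apply: (mulfI (natS_neq0 R n)).
rewrite mulSn_gbinom -IH mulr_sumr.
(* The weight n + 1 splits as j + (n + 1 - j); absorption then produces the factors x - j and y - (n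
   - j), whose sum is x + y - n. *)
transitivity (\sum_(j < n.+2) (j%:R * gbinom x j) * gbinom y (n.+1 - j) +
   \sum_(j < n.+2) gbinom x j * ((n.+1 - j)%:R * gbinom y (n.+1 - j))).
  rewrite -big_split /=; apply: eq_bigr => j _.
  by rewrite natrB -1?ltnS //; ring.
rewrite big_ord_recl /= !mul0r add0r [X in _ + X]big_ord_recr /=.
rewrite subnn mul0r mulr0 addr0 -big_split /= mulr_sumr.
apply: eq_bigr => j _; rewrite /bump /= add1n subSS.
have jn : (j <= n)%N by rewrite -ltnS.
by rewrite mulSn_gbinom subSn // mulSn_gbinom natrB //; ring.
Qed.

Lemma gbinom_trinomial (R : realType) (x : R) (i k : nat) :
  gbinom x (i + k) * 'C(i + k, i)%:R = gbinom x i * gbinom (x - i%:R) k.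
Proof.
have := bin_fact (leq_addr k i).
rewrite addKn => /(congr1 (fun m => m%:R : R)); rewrite !natrM => E.
rewrite /gbinom big_split_ord /=.
rewrite [X in _ * X / _](eq_bigr (fun l : 'I_k => x - i%:R - l%:R)); last first.
  by move=> l _; rewrite natrD opprD addrA.
have /mulIf := fact_neq0 R (i + k); apply.
rewrite mulrAC divfK ?fact_neq0 // -E.
by field; rewrite !fact_neq0.
Qed.

Lemma gbinomN (R : realType) (y : R) (k : nat) :
  gbinom (- y) k = (- 1) ^+ k * gbinom (y + k%:R - 1) k.
Proof.
rewrite /gbinom mulrA; congr (_ / _).
rewrite (reindex_inj rev_ord_inj) /=.
rewrite -[k in (- 1) ^+ k]card_ord -prodr_const -big_split /=.
apply: eq_bigr => i _; rewrite natrB // -natr1; ring.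
Qed.

Lemma gbinom_nat_eq0 (R : realType) (m k : nat) :
  (m < k)%N -> gbinom (m%:R : R) k = 0.
Proof.
move=> mk; rewrite /gbinom (bigD1 (Ordinal mk)) //=.
by rewrite subrr !mul0r.
Qed.

Lemma gbinom_neq0 (R : realType) (y : R) (k : nat) :
  (forall i, (i < k)%N -> y != i%:R) -> gbinom y k != 0.
Proof.
move=> yi; rewrite mulf_neq0 ?invr_eq0 ?fact_neq0 //.
by apply/prodf_neq0 => i _; rewrite subr_eq0 yi.
Qed.

Lemma gbinom_negn_neq0 (R : realType) (n k : nat) :
  (0 < n)%N -> gbinom (- n%:R : R) k != 0.
Proof.
move=> n0; apply: gbinom_neq0 => i _.
by rewrite eqr_oppLR -subr_eq0 opprK -natrD pnatr_eq0; case: n n0.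
Qed.

(** * Meixner polynomials around a = 1 *)

(** Expand u^j = (1 + (u - 1))^j and exchange the sums: trinomial revision pulls C(x, i) out, and
    Vandermonde sums the rest. *)
Lemma gbinom_convolution_exp (R : realType) (x y u : R) (n : nat) :
  \sum_(j < n.+1) u ^+ j * gbinom x j * gbinom y (n - j) =
  \sum_(i < n.+1) (u - 1) ^+ i * gbinom x i * gbinom (x + y - i%:R) (n - i).
Proof.
transitivity (\sum_(j < n.+1) \sum_(i < n.+1)
    (u - 1) ^+ i * (gbinom x j * 'C(j, i)%:R * gbinom y (n - j))).
  apply: eq_bigr => j _; rewrite -[u in LHS](subrK 1) exprD1n.
  rewrite !mulr_suml (big_ord_widen n.+1
     (fun i => (u - 1) ^+ i *+ 'C(j, i) * gbinom x j * gbinom y (n - j))) //.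
  rewrite big_mkcond /=; apply: eq_bigr => i _.
  rewrite ltnS; case: leqP => ij; last by rewrite bin_small // !(mulr0, mul0r).
  by rewrite mulr_natr; ring.
rewrite exchange_big /=; apply: eq_bigr => i _.
have iN : (i <= n)%N by rewrite -ltnS.
rewrite -mulr_sumr -mulrA; congr (_ * _).
rewrite -(big_mkord xpredT (fun j => gbinom x j * 'C(j, i)%:R * gbinom y (n - j))).
rewrite (big_cat_nat (n := i)) ?(leqW iN) //=.
rewrite big_nat_cond big1 => [|j]; last first.
  by rewrite andbT => /bin_small->; rewrite mulr0 mul0r.
rewrite add0r -[X in \sum_(X <= _ < _) _]add0n big_addn subSn // big_mkord.
have -> : x + y - i%:R = (x - i%:R) + y by ring.
rewrite -gbinom_vandermonde mulr_sumr; apply: eq_bigr => k _.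
by rewrite [(k + i)%N]addnC gbinom_trinomial subnDA mulrA.
Qed.

Lemma meixner_expansion (R : realType) (a c x : R) (n : nat) :
  meixner a c n x = (a / (1 - a)) ^+ n *
  \sum_(j < n.+1) (a^-1 - 1) ^+ j * gbinom x j * gbinom (- c - j%:R) (n - j).
Proof.
rewrite /meixner expr_div_n; congr (_ * _).
under eq_bigr => j _ do rewrite -exprVn.
rewrite gbinom_convolution_exp; apply: eq_bigr => j _.
by congr (_ * gbinom _ _); ring.
Qed.

(* (a - 1)^n m_n^{a,c}(x / (1 - a)), as a polynomial in a *)
Definition scaled_meixner (R : realType) (c x : R) (n : nat) : {poly R} :=
  \sum_(j < n.+1) ((- 1) ^+ n * gbinom (- c - j%:R) (n - j) / j`!%:R) *:
    ('X^(n - j) * \prod_(i < j) (x%:P - i%:R *: (1 - 'X))).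

(** The factor (1 - a)^j coming from (1/a - 1)^j clears the denominators of C(x / (1 - a), j), and
    a^n absorbs a^-j. *)
Lemma horner_scaled_meixner (R : realType) (a c x : R) (n : nat) :
  a != 0 -> a != 1 ->
  (scaled_meixner c x n).[a] = (a - 1) ^+ n * meixner a c n (x / (1 - a)).
Proof.
move=> a0 a1; have a1' : 1 - a != 0 by rewrite subr_eq0 eq_sym.
rewrite meixner_expansion mulrA -exprMn.
have -> : (a - 1) * (a / (1 - a)) = - a by field.
rewrite /scaled_meixner horner_sum mulr_sumr; apply: eq_bigr => j _.
have jn : (j <= n)%N by rewrite -ltnS.
rewrite hornerZ hornerM hornerXn horner_prod /gbinom.
have -> : \prod_(i < j) (x%:P - i%:R *: (1 - 'X)).[a] =
    (1 - a) ^+ j * \prod_(i < j) (x / (1 - a) - i%:R).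
  rewrite -[j in (1 - a) ^+ j]card_ord -prodr_const -big_split /=.
  by apply: eq_bigr => i _; rewrite !hornerE; field.
have -> : a^-1 - 1 = (1 - a) / a by field.
have an : a ^+ n = a ^+ (n - j) * a ^+ j by rewrite -exprD subnK.
rewrite expr_div_n [(- a) ^+ n]exprNn an.
by field; rewrite !fact_neq0 expf_neq0.
Qed.

Lemma horner1_scaled_meixner (R : realType) (c x : R) (n : nat) :
  (scaled_meixner c x n).[1] = laguerre (c - 1) n x.
Proof.
rewrite /scaled_meixner horner_sum; apply: eq_bigr => j _.
have jn : (j <= n)%N by rewrite -ltnS.
rewrite hornerZ hornerM hornerXn expr1n mul1r horner_prod.
under eq_bigr => i _ do rewrite !hornerE subrr mulr0 subr0.
(* Upper negation turns C(-c-j, n-j) into (-1)^(n-j) C(n+c-1, n-j). *)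
rewrite prodr_const card_ord -opprD gbinomN natrB //.
have -> : c + j%:R + (n%:R - j%:R) - 1 = n%:R + (c - 1) by ring.
have -> : (- x) ^+ j = (- 1) ^+ n * (- 1) ^+ (n - j) * x ^+ j.
  have -> : (- 1) ^+ n = (- 1) ^+ (n - j) * (- 1) ^+ j :> R.
    by rewrite -exprD subnK.
  by rewrite [X in X * x ^+ j]mulrAC -expr2 sqrr_sign mul1r -exprNn.
by ring.
Qed.

(** * Limit of the Krall quotient *)

Lemma cvg_horner_dnbhs (R : realType) (p : {poly R}) (t : R) :
  p.[a] @[a --> t^'] --> p.[t].
Proof. by apply: cvg_within_filter; apply: continuous_horner. Qed.

Lemma near1_neq01 (R : realType) : \forall a \near (1 : R)^', a != 0 /\ a != 1.
Proof.
near=> a; split; last by near: a; exact: nbhs_dnbhs_neq.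
rewrite -[a]hornerX; near: a.
by apply: (cvgr_neq0 _ (@cvg_horner_dnbhs R 'X 1)); rewrite hornerX oner_neq0.
Unshelve. all: by end_near. Qed.

(* m_kappa^{1/a,2-c}(y) up to the factor (a - 1)^r and a factor independent
   of y, as a polynomial in a; faithful when the coefficients
   gbinom (c - 2 - j) (kappa - j) vanish for j < r. *)
Definition krall_factor (R : realType) (c : R) (kappa r : nat) (y : R) :
    {poly R} :=
  \sum_(j < kappa.+1) (gbinom y j * gbinom (c - 2 - j%:R) (kappa - j)) *:
    ('X - 1%:P) ^+ (j - r).

Lemma meixner_krall_factor (R : realType) (a c y : R) (kappa r : nat) :
  (forall j, (j < r)%N -> gbinom (c - 2 - j%:R) (kappa - j) = 0) ->
  meixner (1 / a) (2 - c) kappa y =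
  (1 / a / (1 - 1 / a)) ^+ kappa * (a - 1) ^+ r
    * (krall_factor c kappa r y).[a].
Proof.
move=> d0; rewrite meixner_expansion -mulrA; congr (_ * _).
rewrite horner_sum mulr_sumr; apply: eq_bigr => j _.
rewrite div1r invrK opprB hornerZ horner_exp hornerXsubC.
(* For j < r the truncated exponent [j - r] is 0, but the coefficient vanishes. *)
have [jr|rj] := ltnP j r; first by rewrite d0 // !(mulr0, mul0r).
by rewrite -[in _ ^+ j](subnKC rj) exprD; ring.
Qed.

(** Only j = r survives: smaller indices have zero coefficient, larger ones keep a power of a -
    1. *)
Lemma horner1_krall_factor (R : realType) (c y : R) (kappa r : nat) :
  (r <= kappa)%N ->
  (forall j, (j < r)%N -> gbinom (c - 2 - j%:R) (kappa - j) = 0) ->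
  (krall_factor c kappa r y).[1] =
  gbinom y r * gbinom (c - 2 - r%:R) (kappa - r).
Proof.
move=> rk d0; rewrite horner_sum (bigD1 (inord r)) //= inordK // big1 => [|j].
  by rewrite subnn hornerZ hornerC mulr1 addr0.
rewrite -val_eqE /= inordK // hornerZ horner_exp hornerXsubC subrr expr0n subn_eq0.
case: (ltngtP j r) => [jr|rj|//] _; first by rewrite d0 // !(mulr0, mul0r).
by rewrite mulr0.
Qed.

(** The two absorption rules give (y - r) C(y, r) = y C(y - 1, r), taken at y = -n. *)
Lemma gbinom_negn_ratio (R : realType) (n r : nat) :
  (0 < n)%N ->
  gbinom (- n%:R - 1 : R) r / gbinom (- n%:R) r = (n%:R + r%:R) / n%:R.
Proof.
move=> n0; have nz : n%:R != 0 :> R by rewrite pnatr_eq0 -lt0n.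
apply/eqP; rewrite eqr_div ?gbinom_negn_neq0 //; apply/eqP.
have := mulSn_gbinom_pred (- n%:R : R) r; rewrite mulSn_gbinom => E.
by apply: oppr_inj; rewrite mulrC -mulNr -E; ring.
Qed.

Lemma meixner_krall_prefactor_neq0 (R : realType) (a : R) (kappa r : nat) :
  a != 0 -> a != 1 -> (1 / a / (1 - 1 / a)) ^+ kappa * (a - 1) ^+ r != 0.
Proof.
move=> a0 a1; rewrite mulf_neq0 ?expf_neq0 ?subr_eq0 //.
rewrite div1r mulf_neq0 ?invr_eq0 // subr_eq0 -invr1.
by rewrite (inj_eq invr_inj) eq_sym.
Qed.

Lemma near_meixner_neq0 (R : realType) (c : R) (kappa n r : nat) :
  (0 < n)%N -> (r <= kappa)%N ->
  (forall j, (j < r)%N -> gbinom (c - 2 - j%:R) (kappa - j) = 0) ->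
  gbinom (c - 2 - r%:R) (kappa - r) != 0 ->
  \forall a \near (1 : R)^', meixner (1 / a) (2 - c) kappa (- n%:R) != 0.
Proof.
move=> n0 rk d0 dr; near=> a; have [a0 a1] : a != 0 /\ a != 1 by near: a; exact: near1_neq01.
rewrite (meixner_krall_factor _ _ d0) mulf_neq0 ?meixner_krall_prefactor_neq0 //.
near: a; apply: (cvgr_neq0 _ (@cvg_horner_dnbhs R _ 1)).
by rewrite horner1_krall_factor // mulf_neq0 ?gbinom_negn_neq0.
Unshelve. all: by end_near. Qed.

Lemma cvg_meixner_ratio (R : realType) (c : R) (kappa n r : nat) :
  (0 < n)%N -> (r <= kappa)%N ->
  (forall j, (j < r)%N -> gbinom (c - 2 - j%:R) (kappa - j) = 0) ->
  gbinom (c - 2 - r%:R) (kappa - r) != 0 ->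
  meixner (1 / a) (2 - c) kappa (- n%:R - 1) /
    meixner (1 / a) (2 - c) kappa (- n%:R) @[a --> (1 : R)^'] -->
  ((n%:R + r%:R) / n%:R : R).
Proof.
move=> n0 rk d0 dr; pose Q := krall_factor c kappa r.
apply: (@cvg_trans _ ((Q (- n%:R - 1)).[a] / (Q (- n%:R)).[a] @[a --> (1 : R)^'])).
  apply: near_eq_cvg; near=> a.
  have [a0 a1] : a != 0 /\ a != 1 by near: a; exact: near1_neq01.
  (* The prefactor is independent of y, so it cancels in the quotient. *)
  by rewrite !(meixner_krall_factor _ _ d0) -mulf_div divff ?meixner_krall_prefactor_neq0 ?mul1r.
rewrite -gbinom_negn_ratio //.
have -> : gbinom (- n%:R - 1) r / gbinom (- n%:R) r =
    (Q (- n%:R - 1)).[1] / (Q (- n%:R)).[1].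
  by rewrite !horner1_krall_factor // -[RHS]mulf_div divff // mulr1.
apply: cvgM; first exact: cvg_horner_dnbhs.
apply: cvgV; last exact: cvg_horner_dnbhs.
by rewrite horner1_krall_factor // mulf_neq0 ?gbinom_negn_neq0.
Unshelve. all: by end_near. Qed.

(** * Limit of the Krall Meixner polynomials *)

Lemma cvg_krall_meixner (R : realType) (c x : R) (kappa m r : nat) :
  (r <= kappa)%N ->
  (forall j, (j < r)%N -> gbinom (c - 2 - j%:R) (kappa - j) = 0) ->
  gbinom (c - 2 - r%:R) (kappa - r) != 0 ->
  (a - 1) ^+ m.+1 * krall_meixner a c kappa m.+1 (x / (1 - a))
    @[a --> (1 : R)^'] -->
  laguerre (c - 1) m.+1 x - (m.+1%:R + r%:R) / m.+1%:R * laguerre (c - 1) m x.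
Proof.
move=> rk d0 dr.
pose q a := meixner (1 / a) (2 - c) kappa (- m.+1%:R - 1) /
  meixner (1 / a) (2 - c) kappa (- m.+1%:R).
(* The minus sign comes from (a - 1)^(m+1) / (1 - a) = -(a - 1)^m. *)
apply: (@cvg_trans _ ((scaled_meixner c x m.+1).[a] -
    (('X : {poly R}).[a] * q a) * (scaled_meixner c x m).[a] @[a --> (1 : R)^'])).
  apply: near_eq_cvg; near=> a.
  have [a0 a1] : a != 0 /\ a != 1 by near: a; exact: near1_neq01.
  have a1' : 1 - a != 0 by rewrite subr_eq0 eq_sym.
  have Mz : meixner (1 / a) (2 - c) kappa (- m.+1%:R) != 0.
    by near: a; exact: near_meixner_neq0 d0 dr.
  rewrite !horner_scaled_meixner // hornerX /q /krall_meixner exprS.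
  by field; rewrite Mz.
have -> : (m.+1%:R + r%:R) / m.+1%:R =
    ('X : {poly R}).[1] * ((m.+1%:R + r%:R) / m.+1%:R) :> R.
  by rewrite hornerX mul1r.
rewrite -!horner1_scaled_meixner.
apply: cvgB; first exact: cvg_horner_dnbhs.
apply: cvgM; last exact: cvg_horner_dnbhs.
apply: cvgM; first exact: cvg_horner_dnbhs.
exact: cvg_meixner_ratio.
Unshelve. all: by end_near. Qed.

(** * The generic and exceptional values of c *)

Lemma laguerre_diff (R : realType) (alpha x : R) (m : nat) :
  laguerre alpha m.+1 x - laguerre alpha m x = laguerre (alpha - 1) m.+1 x.
Proof.
rewrite /laguerre big_ord_recr [in RHS]big_ord_recr /= subnn !gbinom0.
rewrite addrAC -sumrB; congr (_ + _); apply: eq_bigr => j _.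
have jm : (j <= m)%N by rewrite -ltnS.
rewrite subSn //.
have -> : m.+1%:R + alpha = m%:R + alpha + 1 :> R by rewrite -natr1; ring.
have -> : m.+1%:R + (alpha - 1) = m%:R + alpha :> R by rewrite -natr1; ring.
by rewrite gbinom_pascal; ring.
Qed.

(** With c = k, the upper entry k - 2 - j is a natural number below kappa - j until j = k - 1, where
    it becomes -1. *)
Lemma krall_exceptional_coeff (R : realType) (kappa k : nat) :
  (2 <= k < kappa.+2)%N ->
  (forall j, (j < k.-1)%N -> gbinom (k%:R - 2 - j%:R : R) (kappa - j) = 0) /\
  gbinom (k%:R - 2 - k.-1%:R : R) (kappa - k.-1) != 0.
Proof.
case: k => [//|[//|i]] /=; rewrite !ltnS => ik; split=> [j jk|].
  have -> : i.+2%:R - 2 - j%:R = (i - j)%:R :> R.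
    by rewrite natrB // -!natr1; ring.
  by rewrite gbinom_nat_eq0 // ltn_sub2r // (leq_trans jk).
have -> : i.+2%:R - 2 - i.+1%:R = - 1%:R :> R by rewrite -!natr1; ring.
exact: gbinom_negn_neq0.
Qed.

Lemma krall_generic_coeff (R : realType) (kappa : nat) (c : R) :
  c \notin [seq k%:R | k <- index_iota 2 kappa.+2] ->
  gbinom (c - 2 - 0%:R) (kappa - 0) != 0.
Proof.
move=> cN; rewrite subr0 subn0; apply: gbinom_neq0 => i ik.
apply: contra cN => /eqP ci; apply/mapP; exists i.+2.
  by rewrite mem_index_iota /= !ltnS.
by rewrite -[LHS](subrK 2) ci -!natr1; ring.
Qed.

(* The limit is taken over the parameters a for which the polynomial is
   defined; the first conjunct says that a can tend to 1 inside this domain,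
   so that the limit is meaningful. *)
Theorem mainTheorem1 (R : realType) (kappa : nat) (hkappa : (0 < kappa)%N)
    (c : R) (n : nat) (x : R) :
  limit_point (krall_meixner_dom c kappa n) (1 : R) /\
  (a - 1) ^+ n * krall_meixner a c kappa n (x / (1 - a))
    @[a --> within (krall_meixner_dom c kappa n) (1 : R)^'] -->
  (if c \notin [seq k%:R | k <- index_iota 2 kappa.+2]
   then laguerre (c - 2) n x
   else laguerre_infty (c - 1) n x).
Proof.
(* Both cases reduce to one index r, namely 0 or c - 1; degree 0 stays apart, its polynomial being
   constant. *)
have [r [rk d0 dr lim]] : exists r, [/\ (r <= kappa)%N,
    forall j, (j < r)%N -> gbinom (c - 2 - j%:R) (kappa - j) = 0,
    gbinom (c - 2 - r%:R) (kappa - r) != 0 &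
    (if c \notin [seq k%:R | k <- index_iota 2 kappa.+2]
     then laguerre (c - 2) n x else laguerre_infty (c - 1) n x) =
    if n is m.+1 then laguerre (c - 1) n x -
        (n%:R + r%:R) / n%:R * laguerre (c - 1) m x else 1].
  have [|cN] := boolP (c \in _); last first.
    exists 0%N; split => //; first exact: krall_generic_coeff.
    case: n => [|m] /=; first by rewrite /laguerre big_ord1 gbinom0 divr1 mulr1.
    rewrite addr0 divff ?natS_neq0 // mul1r laguerre_diff.
    by congr laguerre; ring.
  move=> /mapP[k]; rewrite mem_index_iota => k2 ->.
  have [d0 dr] := krall_exceptional_coeff R k2.
  exists k.-1; split => //; first by case: k k2 {d0 dr} => [//|[//|k]].
  have -> : k%:R - 1 = k.-1%:R :> R.
    by case: k k2 {d0 dr} => [//|k] _; rewrite -natr1 addrK.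
  by case: n.
rewrite lim; split.
- move=> U U1.
  have M : \forall a \near (1 : R)^', (0 < n)%N ->
      meixner (1 / a) (2 - c) kappa (- n%:R) != 0.
    have [->|n0] := posnP n; first exact: nearW.
    by apply: filterS (near_meixner_neq0 n0 rk d0 dr).
  have [a [[Ma [a0 a1]] Ua]] :=
    filter_ex (filterI (filterI M (near1_neq01 R)) (nbhs_dnbhs U1)).
  by exists a.
(* Restricting to the domain refines the filter, so the limit over the whole punctured neighbourhood
   suffices. *)
- apply: cvg_within_filter; case: n {lim} => [|m]; last exact: cvg_krall_meixner.
  under eq_cvg do rewrite expr0 mul1r.
  exact: cvg_cst.
Qed.
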